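(* The class $\mathrm{EL}_2$ is not closed under intersection, not closed under union, not closed under exclusive-or (symmetric difference), and not closed under equivalence (complement of symmetric difference). That is, for each of these binary Boolean operations $\circ$ there exist $A_1,A_2\in\mathrm{EL}_2$ with $A_1\circ A_2\notin\mathrm{EL}_2$.
   Context: All sets are languages over $\Sigma=\{0,1\}$. For sets $A,B$, $A\oplus B = \{0x \mid x\in A\}\cup\{1x\mid x\in B\}$; SAT is the set of satisfiable Boolean formulas. $\mathrm{EL}_2=\{L \mid \mathrm{NP}^{\mathrm{NP}^L} = \mathrm{NP}^{L\oplus\mathrm{SAT}}\}$ (the second level of the extended low hierarchy). The equivalence of $A$ and $B$ is $\{x \mid x\in A \Leftrightarrow x\in B\}$. *)

(* Defs.v *)
From HB Require Import structures.
From mathcomp Require Import all_boot all_order all_algebra.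
From mathcomp Require Import boolp classical_sets.

Set Implicit Arguments.
Unset Strict Implicit.
Unset Printing Implicit Defensive.

Local Open Scope classical_set_scope.

Definition word := seq bool.
Definition language := set word.

Definition join (A B : language) : language :=
  [set false :: x | x in A] `|` [set true :: x | x in B].

Definition equivalence (A B : language) : language := [set x | A x <-> B x].

(** Nondeterministic oracle Turing machines with several two-way infinite
    read-write tapes, the first of which initially holds the input, and a
    write-only oracle tape that is erased by each query. *)

Inductive move := Lft | Stay | Rgt.

Definition move_code (m : move) : option bool :=
  match m with Lft => Some false | Stay => None | Rgt => Some true end.
Definition move_decode (o : option bool) : move :=
  match o with Some false => Lft | None => Stay | Some true => Rgt end.
Lemma move_codeK : cancel move_code move_decode. Proof. by case. Qed.
HB.instance Definition _ := Finite.copy move (can_type move_codeK).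

(** [None] is the blank, [Some (inl b)] the input bit [b], and
    [Some (inr a)] one of [g] auxiliary symbols. *)
Definition symbol (g : nat) : finType := option (bool + 'I_g)%type.

Section Tape.
Variable g : nat.

(** [(l, r)] is the tape [rev l ++ r] surrounded by blanks, with the head on
    the first cell of [r]. *)
Definition tape := (seq (symbol g) * seq (symbol g))%type.

Definition tape_read (t : tape) : symbol g := head None t.2.

Definition tape_act (a : symbol g * move) (t : tape) : tape :=
  let: (l, r) := t in
  let: (s, m) := a in
  match m with
  | Lft => (behead l, head None l :: s :: behead r)
  | Stay => (l, s :: behead r)
  | Rgt => (s :: l, behead r)
  end.

Definition input_tape (x : word) : tape := ([::], [seq Some (inl b) | b <- x]).
Definition blank_tape : tape := ([::], [::]).

End Tape.

(** An action consists of the next state, the symbol written and the head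
    move on each tape, and optionally a bit appended to the oracle tape. *)
Definition action (q g k : nat) : finType :=
  ('I_q * k.-tuple (symbol g * move) * option bool)%type.

Record machine := Machine {
  nstates : nat;
  nsymbols : nat;
  ntapes : nat; (* number of tapes besides the input and oracle tapes *)
  start : 'I_nstates;
  accept : 'I_nstates;
  query : 'I_nstates;
  answer_yes : 'I_nstates;
  answer_no : 'I_nstates;
  delta : {ffun 'I_nstates * (ntapes.+1).-tuple (symbol nsymbols) ->
                {set action nstates nsymbols ntapes.+1}}
}.

Section Computation.
Variables (M : machine) (A : language).

Record config := Config {
  state : 'I_(nstates M);
  tapes : (ntapes M).+1.-tuple (tape (nsymbols M));
  oracle_tape : word
}.

Definition initial (x : word) : config :=
  Config (start M)
    [tuple if i == ord0 then input_tape _ x else blank_tape _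
          | i < (ntapes M).+1] [::].

Definition apply_action (a : action (nstates M) (nsymbols M) (ntapes M).+1)
    (c : config) : config :=
  let: (q, acts, o) := a in
  Config q
    [tuple tape_act (tnth acts i) (tnth (tapes c) i) | i < (ntapes M).+1]
    (if o is Some b then rcons (oracle_tape c) b else oracle_tape c).

(** A computation halts in the accepting state, or by having no applicable
    transition. *)
Inductive step (c : config) : config -> Prop :=
| step_delta a of
    state c != accept M & state c != query M &
    a \in delta M (state c, map_tuple (@tape_read _) (tapes c)) :
    step c (apply_action a c)
| step_yes of
    state c != accept M & state c = query M & A (oracle_tape c) :
    step c (Config (answer_yes M) (tapes c) [::])
| step_no of
    state c != accept M & state c = query M & ~ A (oracle_tape c) :
    step c (Config (answer_no M) (tapes c) [::]).

Fixpoint steps (n : nat) (c c' : config) : Prop :=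
  if n is m.+1 then exists2 d, step c d & steps m d c' else c = c'.

Definition accepts (x : word) : Prop :=
  exists n c, steps n (initial x) c /\ state c = accept M.

(** Every computation path, accepting or not, is of polynomial length. *)
Definition polytime : Prop :=
  exists p : {poly nat}, forall x n c,
    steps n (initial x) c -> (n <= p.[size x]%R)%N.

End Computation.

Definition NP_oracle (A : language) : set language :=
  [set L | exists M : machine,
     polytime M A /\ forall x, L x <-> accepts M A x].

Definition NP_class (C : set language) : set language :=
  \bigcup_(B in C) NP_oracle B.

(** Boolean formulas; variables are indexed by binary words. *)
Inductive formula :=
| Var of word
| Neg of formula
| And of formula & formula
| Or of formula & formula.

Fixpoint eval (v : word -> bool) (f : formula) : bool :=
  match f with
  | Var w => v w
  | Neg f => ~~ eval v f
  | And f h => eval v f && eval v h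
  | Or f h => eval v f || eval v h
  end.

Definition satisfiable (f : formula) : Prop := exists v, eval v f.

(** Prefix notation with two-bit tags; the index of a variable is made
    self-delimiting by a [true] before each of its bits and a final [false]. *)
Fixpoint encode (f : formula) : word :=
  match f with
  | Var w => [:: false; false] ++ flatten [seq [:: true; b] | b <- w] ++ [:: false]
  | Neg f => [:: false; true] ++ encode f
  | And f h => [:: true; false] ++ encode f ++ encode h
  | Or f h => [:: true; true] ++ encode f ++ encode h
  end.

Lemma encode_prefix_inj f h s t :
  encode f ++ s = encode h ++ t -> f = h /\ s = t.
Proof.
elim: f h s t => [w|f IH|f IHf f' IHf'|f IHf f' IHf'] [w'|h|h h'|h h'] s t //=.
- case; elim: w w' => [|b w IH] [|b' w'] //=; first by case.
  by case=> -> /IH [[->] ->].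
- by case=> /IH [-> ->].
- by case; rewrite -!catA => /IHf [->] /IHf' [-> ->].
- by case; rewrite -!catA => /IHf [->] /IHf' [-> ->].
Qed.

Lemma encode_inj : injective encode.
Proof.
by move=> f h e; case: (@encode_prefix_inj f h [::] [::]); rewrite ?e.
Qed.

Definition SAT : language := [set encode f | f in satisfiable].

Definition EL2 : set language :=
  [set L | NP_class (NP_oracle L) = NP_oracle (join L SAT)].

(* Main.v *)
(** Fix D and let K be a self-referential set: a word of K names an oracle A of the
    form D + K, a machine M, a word y and a padding 1^t, and tells whether M with
    oracle A accepts y within t steps. This is well-founded, since M only asks about
    words shorter than the padding. K makes A so strong that NP^(NP^A) = NP^A: an
    NP^(NP^A) machine can replace every question to its oracle by a question to K,
    with a polynomially long padding. So A is in EL_2 whatever D is, and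
    likewise for all variants where K is complemented or D is replaced by a trivial
    set. Each of the four operations, applied to two such sets, cancels K and
    leaves D (up to trivial parts), and D can be chosen by the
    Baker-Gill-Solovay diagonalization such that { x | no word of length |x| is in D },
    which is in NP^(NP^D), is not in NP^(D + SAT).

    The padding length need not be computed by the simulating machine: K also tells
    whether a given padding is already long enough, so the machine writes ones
    until K says stop. *)

From HB Require Import structures.
Require Import Defs.
From mathcomp Require Import all_boot all_order all_algebra.
From mathcomp Require Import boolp classical_sets.
From mathcomp Require Import zify.

Set Implicit Arguments.
Unset Strict Implicit.
Unset Printing Implicit Defensive.

Local Open Scope classical_set_scope.

(** * Polynomial time bounds *)

(** A bound of this shape is given by the single number [k], so a clock can be coded in a word. As
    the base is at least 2, a coefficient [c] is absorbed by [(n + 2) ^ c]. *)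
Lemma horner_nat_bound (p : {poly nat}) :
  exists k, forall n, p.[n]%R <= (n + 2) ^ k.
Proof.
elim/poly_ind: p => [|p c [k hk]]; first by exists 0 => n; rewrite horner0.
exists (k + c).+1 => n; rewrite hornerMXaddC.
have hc : c <= (n + 2) ^ c.
  by apply: ltnW; apply: ltn_expl; rewrite addn2.
have := hk n; move: (p.[n])%R => u hu.
change (u * n + c <= (n + 2) ^ (k + c).+1).
have a1 : 0 < (n + 2) ^ k by rewrite expn_gt0 addn2.
have a2 : 0 < (n + 2) ^ c by rewrite expn_gt0 addn2.
rewrite expnS expnD; move: ((n + 2) ^ k) ((n + 2) ^ c) a1 a2 hu hc => a b a0 b0 ua cb.
have h1 : u * n <= a * b * n by rewrite leq_mul2r (leq_trans ua) ?orbT ?leq_pmulr.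
have h2 : c <= a * b by rewrite (leq_trans cb) ?leq_pmull.
by apply: leq_trans (leq_add h1 h2) _; rewrite mulnDl mulnC leq_add2l leq_pmull.
Qed.

Lemma horner_nat_leq (p : {poly nat}) m n : m <= n -> p.[m]%R <= p.[n]%R.
Proof.
move=> mn; elim/poly_ind: p => [|p c IH]; first by rewrite !horner0.
rewrite !hornerMXaddC; exact: leq_add (leq_mul IH mn) _.
Qed.

Lemma horner_nat_pow k n : (('X + 2%:P) ^+ k : {poly nat}).[n]%R = (n + 2) ^ k.
Proof. by rewrite horner_exp hornerD hornerX hornerC. Qed.

(** * Tapes up to surrounding blanks *)

Section TapeEq.
Variable g : nat.
Implicit Types (t u : tape g) (w l r : word).

(** One tape has many representations, which differ in trailing blanks; the default [None] of [nth]
    is the blank. *)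
Definition tape_eq t u : Prop :=
  nth None t.1 =1 nth None u.1 /\ nth None t.2 =1 nth None u.2.

Lemma tape_eq_refl t : tape_eq t t. Proof. by []. Qed.

Lemma tape_eq_trans t u v : tape_eq t u -> tape_eq u v -> tape_eq t v.
Proof. by move=> [h1 h2] [h3 h4]; split=> i; rewrite ?h1 ?h2. Qed.

Lemma tape_eq_read t u : tape_eq t u -> tape_read t = tape_read u.
Proof. by case=> _ h; rewrite /tape_read -!nth0 h. Qed.

Lemma tape_eq_act a t u : tape_eq t u -> tape_eq (tape_act a t) (tape_act a u).
Proof.
case: a t u => s m [l r] [l' r'] [/= h1 h2].
case: m; split=> /= i; rewrite ?nth_behead ?h1 ?h2 //.
- by case: i => [|[|i]] /=; rewrite -?nth0 ?nth_behead ?h1 ?h2.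
- by case: i => [|i] /=; rewrite ?nth_behead ?h2.
- by case: i => [|i] /=; rewrite ?h1.
Qed.

Lemma tape_eq_stay t : tape_eq (tape_act (tape_read t, Stay) t) t.
Proof. by case: t => l [|s r]; split=> // -[|[]]. Qed.

Definition bits w : seq (symbol g) := [seq Some (inl b) | b <- w].

(** The tape [rev l ++ r] with the head on the first cell of [r]. *)
Definition zipper l r : tape g := (bits l, bits r).

(** The same tape with the head one cell further left, on a blank when [l] is empty. *)
Definition zipper_left l r : tape g :=
  (behead (bits l), head None (bits l) :: bits r).

Lemma zipper_left_end l :
  tape_eq (tape_act (None, Lft) (zipper l [::])) (zipper_left l [::]).
Proof. by split; do 4?case. Qed.

Lemma zipper_left_nil r :
  tape_eq (tape_act (None, Rgt) (zipper_left [::] r)) (zipper [::] r).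
Proof. by split; do 4?case. Qed.

End TapeEq.

Section TapesEq.
Variables (g k : nat).
Implicit Types (ts us : k.-tuple (tape g)) (acts : k.-tuple (symbol g * move)).

Definition tapes_eq ts us : Prop := forall i, tape_eq (tnth ts i) (tnth us i).

Lemma tapes_eq_refl ts : tapes_eq ts ts. Proof. by move=> i; exact: tape_eq_refl. Qed.

Lemma tapes_eq_trans ts us vs : tapes_eq ts us -> tapes_eq us vs -> tapes_eq ts vs.
Proof. by move=> h h' i; apply: tape_eq_trans (h i) (h' i). Qed.

Definition tapes_read ts : k.-tuple (symbol g) := map_tuple (@tape_read g) ts.

Definition tapes_act acts ts : k.-tuple (tape g) :=
  [tuple tape_act (tnth acts i) (tnth ts i) | i < k].

Definition stays (v : k.-tuple (symbol g)) : k.-tuple (symbol g * move) :=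
  map_tuple (fun s => (s, Stay)) v.

Lemma tapes_eq_read ts us : tapes_eq ts us -> tapes_read ts = tapes_read us.
Proof.
by move=> h; apply: eq_from_tnth => i; rewrite !tnth_map; apply: tape_eq_read.
Qed.

Lemma tapes_eq_act acts ts us :
  tapes_eq ts us -> tapes_eq (tapes_act acts ts) (tapes_act acts us).
Proof. by move=> h i; rewrite !tnth_mktuple; apply: tape_eq_act. Qed.

Lemma tapes_eq_stays ts : tapes_eq (tapes_act (stays (tapes_read ts)) ts) ts.
Proof. by move=> i; rewrite tnth_mktuple !tnth_map; apply: tape_eq_stay. Qed.

End TapesEq.

Section TapesCons.
Variables (g k : nat).
Implicit Types (ts us : k.-tuple (tape g)) (t u : tape g).
Implicit Types (acts : k.-tuple (symbol g * move)).

Lemma tapes_eq_cons t u ts us :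
  tape_eq t u -> tapes_eq ts us -> tapes_eq [tuple of t :: ts] [tuple of u :: us].
Proof. by move=> h h' i; case: (unliftP ord0 i) => [j|] ->; rewrite ?tnthS ?tnth0. Qed.

Lemma tapes_read_cons t ts :
  tapes_read [tuple of t :: ts] = [tuple of tape_read t :: tapes_read ts].
Proof. exact: val_inj. Qed.

Lemma tapes_act_cons a acts t ts :
  tapes_act [tuple of a :: acts] [tuple of t :: ts]
  = [tuple of tape_act a t :: tapes_act acts ts].
Proof.
apply: eq_from_tnth => i; rewrite tnth_mktuple.
by case: (unliftP ord0 i) => [j|] ->; rewrite ?tnthS ?tnth0 ?tnth_mktuple.
Qed.

End TapesCons.

(** * Computations *)

Section Runs.
Variables (M : machine) (A : language).
Implicit Types c d : config M.

Definition bounded n c : Prop := forall m d, steps A m c d -> m <= n.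

Definition accepting c : Prop := exists n d, steps A n c d /\ state d = accept M.

(** Time and acceptance are kept together, so that one induction along a computation yields both
    requirements of membership in NP. *)
Definition runs n c (P : Prop) : Prop := bounded n c /\ (accepting c <-> P).

Lemma bounded_step n c d : bounded n c -> step A c d -> 0 < n /\ bounded n.-1 d.
Proof.
move=> h s; split; first by apply: (h 1 d); exists d.
move=> m e sm; have : m.+1 <= n by apply: (h _ e); exists d.
by case: n {h}.
Qed.

Lemma boundedS n c : (forall d, step A c d -> bounded n d) -> bounded n.+1 c.
Proof.
move=> h; case=> [|m] d; first by move=> _; exact: leq0n.
by case=> e s sm; rewrite ltnS (h e s m d sm).
Qed.

Lemma accepting_step c :
  accepting c <-> state c = accept M \/ exists2 d, step A c d & accepting d.
Proof.
split=> [[[|n]] [d [/= s ha]]|[ha|[d s [n [e [sn ha]]]]]].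
- by left; rewrite s.
- by case: s => e s sn; right; exists e => //; exists n, d.
- by exists 0, c.
- by exists n.+1, e; split=> //; exists d.
Qed.

Lemma accept_no_step c d : state c = accept M -> ~ step A c d.
Proof. by move=> h; case; rewrite h eqxx. Qed.

Lemma accepts_bounded c n : bounded n c ->
  accepting c <-> exists2 m, m <= n & exists2 d, steps A m c d & state d = accept M.
Proof.
move=> h; split=> [[m [d [s ha]]]|[m _ [d s ha]]]; last by exists m, d.
by exists m; [exact: h s|exists d].
Qed.

(** A path depends only on the oracle answers it receives, and a step writes at most one bit of a
    query. This makes the self-reference well-founded, and it lets the diagonalization alter the
    oracle outside finitely many words. *)
Lemma steps_queries n c d : steps A n c d ->
  exists qs : seq word,
    [/\ size qs <= n, forall q, q \in qs -> size q < size (oracle_tape c) + n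
      & forall A' : language, (forall q, q \in qs -> A q <-> A' q) ->
          steps A' n c d].
Proof.
elim: n c => [|n IH] c /=; first by move=> ->; exists [::]; split.
case=> e [a na nq ha|na eq Ao|na eq Ao] /IH[qs [sq lq hq]].
- exists qs; split=> [||A' hA']; first exact: leqW.
    move=> q /lq; move: (a) => [[? ?] [b|]] /=; last by lia.
    by rewrite size_rcons; lia.
  by exists (apply_action a c); [exact: step_delta|exact: hq].
- exists (oracle_tape c :: qs); split=> //= [q|A' hA'].
    by rewrite inE => /orP[/eqP->|/lq/=]; lia.
  exists (Config (answer_yes M) (tapes c) [::]).
    by apply: step_yes => //; apply/(hA' _ (mem_head _ _)).
  by apply: hq => q qq; apply: hA'; rewrite inE qq orbT.
- exists (oracle_tape c :: qs); split=> //= [q|A' hA'].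
    by rewrite inE => /orP[/eqP->|/lq/=]; lia.
  exists (Config (answer_no M) (tapes c) [::]).
    by apply: step_no => //; move/(hA' _ (mem_head _ _)).
  by apply: hq => q qq; apply: hA'; rewrite inE qq orbT.
Qed.

End Runs.

(** * Machines over any finite type of states, and backward reasoning about their runs *)

Section Build.
Variables (S : finType) (g k : nat) (st ac qu ye no : S).
Variable d : S -> k.+1.-tuple (symbol g) ->
  {set S * k.+1.-tuple (symbol g * move) * option bool}.

Definition build : machine :=
  @Machine #|S| g k (enum_rank st) (enum_rank ac) (enum_rank qu) (enum_rank ye)
    (enum_rank no)
    [ffun qv => [set (enum_rank a.1.1, a.1.2, a.2) | a in d (enum_val qv.1) qv.2]%SET].

Definition conf s (ts : k.+1.-tuple (tape g)) (o : word) : config build := @Config build (enum_rank s) ts o.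

Definition emit (o : word) (b : option bool) : word := if b is Some b then rcons o b else o.

Variable A : language.

Lemma build_step s ts o e : step A (conf s ts o) e <->
  s <> ac /\
  ((s <> qu /\ exists2 a, a \in d s (tapes_read ts)
      & e = conf a.1.1 (tapes_act a.1.2 ts) (emit o a.2)) \/
   (s = qu /\ e = conf (if `[< A o >] then ye else no) ts [::])).
Proof.
have neq (x y : S) : (enum_rank x != enum_rank y) <-> x <> y.
  by rewrite (inj_eq enum_rank_inj); split=> [/eqP|] //; move/eqP.
split.
  case=> [a||] /=.
  - move=> /neq h /neq h' ha; split=> //; left; split=> //.
    move: ha; rewrite ffunE /= enum_rankK => /imsetP[b hb ->].
    by exists b.
  - by move=> /neq h /enum_rank_inj h' h''; split=> //; right; rewrite asboolT.
  - by move=> /neq h /enum_rank_inj h' h''; split=> //; right; rewrite asboolF.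
case=> /neq h [[/neq h' [a ha ->]]|[sq ->]].
  apply: (@step_delta build A (conf s ts o) (enum_rank a.1.1, a.1.2, a.2)) => //.
  rewrite /= ffunE /= enum_rankK; apply/imsetP; exists a => //.
rewrite {}sq in h *.
case: asboolP => ho; first exact: (@step_yes build A (conf qu ts o)).
exact: (@step_no build A (conf qu ts o)).
Qed.

(** With all blank-equivalent tapes covered, a claim about a successor may be stated for its most
    convenient representation and then carried back to the present configuration. *)
Definition reach n s (us : k.+1.-tuple (tape g)) (o : word) (P : Prop) : Prop :=
  forall ts : k.+1.-tuple (tape g), tapes_eq ts us -> runs A n (conf s ts o) P.

Lemma reach_eq n s us vs o P : tapes_eq us vs -> reach n s vs o P -> reach n s us o P.
Proof. by move=> h r ts hts; apply: r; apply: tapes_eq_trans hts h. Qed.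

Lemma reach_iff n s us o (P Q : Prop) : (P <-> Q) -> reach n s us o P -> reach n s us o Q.
Proof. by move=> h r ts /r[b a]; split=> //; rewrite a. Qed.

Lemma reach_leq n m s us o P : n <= m -> reach n s us o P -> reach m s us o P.
Proof. by move=> h r ts /r[b a]; split=> // i e /b /leq_trans; apply. Qed.

Lemma reach_accept n us o : reach n ac us o True.
Proof.
move=> ts _; split; last by split=> // _; apply/accepting_step; left.
by move=> [|m] e //= [f s]; case: (@accept_no_step build A (conf ac ts o) f).
Qed.

Lemma reach_step n s us o (P : _ -> Prop) : s <> ac -> s <> qu ->
  (forall a, a \in d s (tapes_read us) ->
     reach n a.1.1 (tapes_act a.1.2 us) (emit o a.2) (P a)) ->
  reach n.+1 s us o (exists2 a, a \in d s (tapes_read us) & P a).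
Proof.
move=> sa sq h ts hts; have hr := tapes_eq_read hts.
have h' a : a \in d s (tapes_read us) ->
    runs A n (conf a.1.1 (tapes_act a.1.2 ts) (emit o a.2)) (P a).
  by move=> /h; apply; apply: tapes_eq_act.
split.
  apply: boundedS => e /build_step[_ [[_ [a ha ->]]|[//]]].
  by move: ha; rewrite hr => /h'[].
rewrite accepting_step; split.
  case=> [/enum_rank_inj //|[e /build_step[_ [[_ [a ha ->]]|[//]]]]].
  by move: ha; rewrite hr => ha acc; exists a => //; case: (h' a ha) => _ <-.
case=> a ha pa; right; exists (conf a.1.1 (tapes_act a.1.2 ts) (emit o a.2)).
  by apply/build_step; split=> //; left; split=> //; exists a; rewrite ?hr.
by case: (h' a ha) => _ ->.
Qed.

Lemma reach_det n s us o a P : s <> ac -> s <> qu ->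
  d s (tapes_read us) = [set a]%SET ->
  reach n a.1.1 (tapes_act a.1.2 us) (emit o a.2) P -> reach n.+1 s us o P.
Proof.
move=> sa sq e r.
apply: (reach_iff _ (@reach_step n s us o (fun=> P) sa sq _)).
  by rewrite e; split=> [[]|] // p; exists a => //; rewrite inE.
by move=> b; rewrite e inE => /eqP->.
Qed.

Lemma reach_dead n s us o : s <> ac -> s <> qu ->
  d s (tapes_read us) = finset.set0 -> reach n.+1 s us o False.
Proof.
move=> sa sq e.
apply: (reach_iff _ (@reach_step n s us o (fun=> False) sa sq _)).
  by split=> // -[].
by move=> a; rewrite e inE.
Qed.

Lemma reach_query n us o P : qu <> ac ->
  reach n (if `[< A o >] then ye else no) us [::] P -> reach n.+1 qu us o P.
Proof.
move=> qa r ts /r[b a]; split.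
  by apply: boundedS => e /build_step[_ [[]|[_ ->]]].
rewrite accepting_step -a; split.
  by case=> [/enum_rank_inj //|[e /build_step[_ [[]|[_ ->]]]]].
move=> acc; right; exists (conf (if `[< A o >] then ye else no) ts [::]) => //.
by apply/build_step; split=> //; right.
Qed.

Lemma reach_initial n x P :
  reach n st [tuple if i == ord0 then input_tape _ x else blank_tape _ | i < k.+1] [::] P ->
  bounded A n (initial build x) /\ (accepts build A x <-> P).
Proof. by move=> /(_ _ (tapes_eq_refl _)). Qed.

End Build.

(** * Copying the input, or guessing a word of the same length, for one query *)

Section Scan.
Variables (p : word) (guess s : bool).

(** [inl i] has written [i] letters of [p]; [inr None] is the query state. *)
Definition scan_state : finType := ('I_(size p).+1 + option bool)%type.

Definition scan_delta (q : scan_state) (v : 1.-tuple (symbol 0)) :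
    {set scan_state * 1.-tuple (symbol 0 * move) * option bool} :=
  match q with
  | inl i =>
    if i < size p then
      [set (inl (inord i.+1) : scan_state, stays v, Some (nth false p i))]%SET
    else if thead v is Some (inl b) then
      [set (q, [tuple (thead v, Rgt)], Some c) | c in [pred c | guess || (c == b)]]%SET
    else [set (inr None : scan_state, stays v, None : option bool)]%SET
  | inr _ => finset.set0
  end.

(** Only [inr (Some true)] accepts and [inr (Some false)] is stuck, so the answer [s] is the
    accepting one; [s = false] gives a complemented query. *)
Definition scan : machine :=
  build (inl ord0) (inr (Some true)) (inr None) (inr (Some s)) (inr (Some (~~ s)))
    scan_delta.

Definition scanned (x y : word) : Prop := if guess then size y = size x else y = x.

Variable A : language.

Let scan_reach := @reach scan_state 0 0 (inl ord0) (inr (Some true)) (inr None)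
  (inr (Some s)) (inr (Some (~~ s))) scan_delta A.

Lemma scan_reach_copy l x o : scan_reach (size x + 3) (inl ord_max)
  [tuple zipper _ l x] o (exists2 y, scanned x y & A (o ++ y) <-> s).
Proof.
elim: x l o => [|b x IH] l o.
  apply: (reach_iff (P := A o <-> s)).
    split=> [h|[y + h]]; first by exists [::]; rewrite ?cats0 // /scanned; case: guess.
    by rewrite /scanned; case: ifP => _ => [/size0nil|] yn; rewrite yn cats0 in h.
  apply: reach_det => //=; first by rewrite ltnn.
  apply: reach_eq (tapes_eq_stays _) _; apply: reach_query => //.
  case: asboolP => h; case: (s) => /=.
  - by apply: (reach_iff (P := True)); [split|exact: reach_accept].
  - by apply: (reach_iff (P := False)); [split=> // -[/(_ h)]|exact: reach_dead].
  - by apply: (reach_iff (P := False)); [split=> // -[_]; move=> /(_ isT)|exact: reach_dead].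
  - by apply: (reach_iff (P := True)); [split|exact: reach_accept].
have E : scan_delta (inl ord_max) (tapes_read [tuple zipper _ l (b :: x)]) =
    [set (inl ord_max : scan_state, [tuple (Some (inl b), Rgt)], Some c)
      | c in [pred c | guess || (c == b)]]%SET.
  by rewrite /= ltnn.
apply: reach_iff; last first.
  apply: (reach_step
    (P := fun a => exists2 y, scanned x y & A (emit o a.2 ++ y) <-> s)) => // a.
  rewrite E => /imsetP[c _ ->] /=; apply: reach_eq (IH (b :: l) _).
  by move=> i; rewrite tnth_mktuple ord1.
rewrite E; split.
  case=> a /imsetP[c + ->] [y]; rewrite inE /= cat_rcons => hc hy ha.
  exists (c :: y) => //; move: hc hy; rewrite /scanned; case: guess => /=.
    by move=> _ ->.
  by move=> /eqP-> ->.
case=> [[|c y]] hy ha; first by move: hy; rewrite /scanned; case: guess.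
exists (inl ord_max, [tuple (Some (inl b), Rgt)], Some c).
  apply/imsetP; exists c => //; rewrite inE; move: hy; rewrite /scanned.
  by case: guess => //= -[-> _].
exists y; last by rewrite /= cat_rcons.
by move: hy; rewrite /scanned; case: guess => -[].
Qed.

Lemma scan_reach_prefix m x i : i <= size p -> m = size p - i ->
  scan_reach (m + (size x + 3)) (inl (inord i)) [tuple zipper _ [::] x] (take i p)
    (exists2 y, scanned x y & A (p ++ y) <-> s).
Proof.
elim: m i => [|m IH] i hi hm.
  have -> : i = size p by lia.
  rewrite take_size (_ : inord _ = ord_max); first exact: scan_reach_copy.
  by apply: val_inj; rewrite /= inordK.
have li : i < size p by lia.
apply: reach_det => //=; first by rewrite inordK // li.
apply: reach_eq (tapes_eq_stays _) _.
by rewrite /= -take_nth //; apply: IH => //; lia.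
Qed.

(** Without guessing this is a reduction that prepends [p]; with guessing it is an existential
    quantifier over the words of the input length. *)
Lemma NP_scan : NP_oracle A [set x | exists2 y, scanned x y & A (p ++ y) <-> s].
Proof.
have R x : bounded A (size p + (size x + 3)) (initial scan x) /\
    (accepts scan A x <-> exists2 y, scanned x y & A (p ++ y) <-> s).
  apply: reach_initial; have := @scan_reach_prefix (size p) x 0.
  rewrite take0 subn0 => /(_ isT erefl); rewrite (_ : inord 0 = ord0); last first.
    by apply: val_inj; rewrite /= inordK.
  by apply: reach_eq => i; rewrite tnth_mktuple ord1.
exists scan; split; last by move=> x; case: (R x) => _ ->.
exists ((size p + 3)%:P + 'X)%R => x n c.
by case: (R x) => h _ /h; rewrite hornerD hornerX hornerC /=; lia.
Qed.

End Scan.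

(** * Simulating oracle computations by padded queries *)

Definition tuple_rest T n (v : n.+1.-tuple T) : n.-tuple T := [tuple of behead v].

Lemma tuple_rest_cons T n (x : T) (v : n.-tuple T) : tuple_rest [tuple of x :: v] = v.
Proof. exact: val_inj. Qed.

Section Simulation.
Variables (N : machine) (c : word).
Let g := nsymbols N.
Let k := ntapes N.

(** [s_run q] simulates state [q] of [N]. [s_rewind m] followed by [s_prefix m i]
    writes [c] and the contents of the first tape on the oracle tape; then the
    machine asks whether that tape must grow ([m = None]) or resumes [N] in
    state [q] ([m = Some q]). *)
Definition sim_state : finType :=
  ('I_(nstates N) + ((bool + option bool) +
    option 'I_(nstates N) * option 'I_(size c).+1))%type.

Definition s_run q : sim_state := inl q.
Definition s_copy : sim_state := inr (inl (inl false)).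
Definition s_rewind_input : sim_state := inr (inl (inl true)).
Definition s_ask : sim_state := inr (inl (inr None)).
Definition s_answer b : sim_state := inr (inl (inr (Some b))).
Definition s_rewind m : sim_state := inr (inr (m, None)).
Definition s_prefix m i : sim_state := inr (inr (m, Some i)).

Definition act1 (v : k.+2.-tuple (symbol g)) a : k.+2.-tuple (symbol g * move) :=
  [tuple of a :: stays (tuple_rest v)].

Definition act2 (v : k.+2.-tuple (symbol g)) a b : k.+2.-tuple (symbol g * move) :=
  [tuple of a :: [tuple of b :: stays (tuple_rest (tuple_rest v))]].

Definition sim_action : finType :=
  (sim_state * k.+2.-tuple (symbol g * move) * option bool)%type.

(** The first tape of the simulator is extra: it stores the padding and rests while [N] works on the
    other tapes. *)
Definition run_action (h : symbol g) (a : action (nstates N) g k.+1) : sim_action :=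
  let: (q, acts, b) := a in (s_run q, [tuple of (h, Stay) :: acts], b).

(** The answer state does not tell which question was asked; the head of the
    first tape does: it is on a blank exactly during the growth phase. *)
Definition sim_delta (s : sim_state) (v : k.+2.-tuple (symbol g)) : {set sim_action} :=
  let h := thead v in
  let h' := thead (tuple_rest v) in
  match s with
  | inl q =>
    if q == query N then [set ((s_ask, stays v, None) : sim_action)]%SET
    else (run_action h @: delta N (q, tuple_rest v))%SET
  | inr (inl (inl false)) =>
    if h is Some (inl b) then
      [set ((s_copy, act2 v (Some (inl false), Rgt) (h, Rgt), None) : sim_action)]%SET
    else [set ((s_rewind_input, act2 v (None, Lft) (None, Lft), None) : sim_action)]%SET
  | inr (inl (inl true)) =>
    if h' is Some _ then
      [set ((s_rewind_input, act2 v (h, Stay) (h', Lft), None) : sim_action)]%SET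
    else [set ((s_rewind None, act2 v (h, Stay) (None, Rgt), None) : sim_action)]%SET
  | inr (inl (inr None)) => finset.set0
  | inr (inl (inr (Some b))) =>
    if h is Some _ then
      [set ((s_rewind (Some (if b then answer_yes N else answer_no N)), stays v, None)
        : sim_action)]%SET
    else if b then
      [set ((s_rewind None, act1 v (Some (inl true), Stay), None) : sim_action)]%SET
    else [set ((s_rewind (Some (start N)), act1 v (None, Lft), None) : sim_action)]%SET
  | inr (inr (m, None)) =>
    if h is Some _ then [set ((s_rewind m, act1 v (h, Lft), None) : sim_action)]%SET
    else [set ((s_prefix m ord0, act1 v (None, Rgt), None) : sim_action)]%SET
  | inr (inr (m, Some i)) =>
    if i < size c then
      [set ((s_prefix m (inord i.+1), stays v, Some (nth false c i)) : sim_action)]%SET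
    else if h is Some (inl b) then
      [set ((s_prefix m i, act1 v (h, Rgt), Some b) : sim_action)]%SET
    else if m is Some q then
      [set ((s_run q, act1 v (None, Lft), Some false) : sim_action)]%SET
    else [set ((s_ask, stays v, None) : sim_action)]%SET
  end.

Definition sim : machine :=
  build s_copy (s_run (accept N)) s_ask (s_answer true) (s_answer false) sim_delta.

(** * Correctness and running time of the simulation *)

Variable X : language.

Let R := @reach sim_state g k.+1 s_copy (s_run (accept N)) s_ask (s_answer true)
  (s_answer false) sim_delta X.

Implicit Types (us : k.+1.-tuple (tape g)) (w l r o : word) (t : tape g).

Lemma R_eq n s t u us o P :
  tape_eq t u -> R n s [tuple of u :: us] o P -> R n s [tuple of t :: us] o P.
Proof. by move=> h; apply: reach_eq; apply: tapes_eq_cons => //; apply: tapes_eq_refl. Qed.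

Lemma act1_eq a t us : tapes_eq
  (tapes_act (act1 (tapes_read [tuple of t :: us]) a) [tuple of t :: us])
  [tuple of tape_act a t :: us].
Proof.
rewrite /act1 tapes_read_cons tuple_rest_cons tapes_act_cons; apply: tapes_eq_cons; first exact: tape_eq_refl.
exact: tapes_eq_stays.
Qed.

Lemma R_act1 n s s' t us o a ob P : s <> s_run (accept N) -> s <> s_ask ->
  sim_delta s (tapes_read [tuple of t :: us]) =
    [set ((s', act1 (tapes_read [tuple of t :: us]) a, ob) : sim_action)]%SET ->
  R n s' [tuple of tape_act a t :: us] (emit o ob) P ->
  R n.+1 s [tuple of t :: us] o P.
Proof. by move=> sa sq e r; apply: reach_det e _ => //=; apply: reach_eq (act1_eq _ _ _) r. Qed.

Lemma R_stays n s s' (us : k.+2.-tuple (tape g)) o ob P :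
  s <> s_run (accept N) -> s <> s_ask ->
  sim_delta s (tapes_read us) = [set ((s', stays (tapes_read us), ob) : sim_action)]%SET ->
  R n s' us (emit o ob) P -> R n.+1 s us o P.
Proof. by move=> sa sq e r; apply: reach_det e _ => //=; apply: reach_eq (tapes_eq_stays _) r. Qed.

Lemma R_rewind m n l r us o P :
  R n (s_prefix m ord0) [tuple of zipper g [::] (catrev l r) :: us] o P ->
  R (size l + n.+1) (s_rewind m) [tuple of zipper_left g l r :: us] o P.
Proof.
elim: l r => [|b l IH] r h /=.
  by apply: R_act1 => //; apply: R_eq h; apply: zipper_left_nil.
by apply: R_act1 => //; apply: R_eq (IH _ h).
Qed.

Lemma R_prefix m n (us : k.+2.-tuple (tape g)) P :
  R n (s_prefix m ord_max) us c P ->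
  R (size c + n) (s_prefix m ord0) us [::] P.
Proof.
move=> h; suff H j i : i <= size c -> j = size c - i ->
    R (j + n) (s_prefix m (inord i)) us (take i c) P.
  have := H (size c) 0; rewrite take0 subn0 (_ : inord 0 = ord0); last first.
    by apply: val_inj; rewrite /= inordK.
  exact.
elim: j i => [|j IH] i hi hj.
  have -> : i = size c by lia.
  rewrite take_size (_ : inord _ = ord_max) //.
  by apply: val_inj; rewrite /= inordK.
have li : i < size c by lia.
apply: R_stays => //=; first by rewrite inordK // li.
by rewrite /= -take_nth //; apply: IH => //; lia.
Qed.

Lemma R_sweep m n l r us o P :
  R n (s_prefix m ord_max) [tuple of zipper g (catrev r l) [::] :: us] (o ++ r) P ->
  R (size r + n) (s_prefix m ord_max) [tuple of zipper g l r :: us] o P.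
Proof.
elim: r l o => [|b r IH] l o /=; first by rewrite cats0.
move=> h; apply: (@R_act1 _ _ (s_prefix m ord_max) _ _ _ (Some (inl b), Rgt) (Some b)) => //=.
  by rewrite ltnn.
by apply: (IH (b :: l)); rewrite /= cat_rcons.
Qed.

(** Rewinding and sweeping each cost at most about [size w], whence the doubled term. *)
Lemma R_load m n l r w us P : catrev l r = w ->
  R n (s_prefix m ord_max) [tuple of zipper g (rev w) [::] :: us] (c ++ w) P ->
  R (size c + (size w).*2 + n.+1) (s_rewind m) [tuple of zipper_left g l r :: us] [::] P.
Proof.
move=> hw h; apply: (@reach_leq _ _ _ _ _ _ _ _ _ _ (size l + (size c + (size w + n)).+1)).
  by rewrite -hw catrevE size_cat size_rev; lia.
by apply: R_rewind; rewrite hw; apply: R_prefix; apply: R_sweep.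
Qed.

(** A query erases the oracle tape, so the prefix is written again before [N] goes on. The final
    [false] separates it from the bits that [N] itself will write. *)
Lemma R_load_run q n l r w us P : catrev l r = w ->
  R n (s_run q) [tuple of zipper_left g (rev w) [::] :: us] (c ++ w ++ [:: false]) P ->
  R (size c + (size w).*2 + n.+2) (s_rewind (Some q)) [tuple of zipper_left g l r :: us]
    [::] P.
Proof.
move=> hw h; apply: R_load hw _.
apply: (@R_act1 _ _ (s_run q) _ _ _ (None, Lft) (Some false)) => //=; first by rewrite ltnn.
by rewrite -cats1 -catA; apply: R_eq h; apply: zipper_left_end.
Qed.

Lemma R_load_ask n l r w us P : catrev l r = w ->
  R n (s_answer `[< X (c ++ w) >]) [tuple of zipper g (rev w) [::] :: us] [::] P ->
  R (size c + (size w).*2 + n.+3) (s_rewind None) [tuple of zipper_left g l r :: us]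
    [::] P.
Proof.
move=> hw h; apply: R_load hw _.
apply: (@R_stays _ _ s_ask _ _ None) => //=; first by rewrite ltnn.
by apply: reach_query => //; case: asboolP h.
Qed.

Lemma act2_eq a b t u (us : k.-tuple (tape g)) : tapes_eq
  (tapes_act (act2 (tapes_read [tuple of t :: [tuple of u :: us]]) a b)
    [tuple of t :: [tuple of u :: us]])
  [tuple of tape_act a t :: [tuple of tape_act b u :: us]].
Proof.
rewrite /act2 !tapes_read_cons !tuple_rest_cons !tapes_act_cons.
do 2!(apply: tapes_eq_cons; first exact: tape_eq_refl).
exact: tapes_eq_stays.
Qed.

Lemma R_act2 n s s' t t' u u' (us : k.-tuple (tape g)) o a b P :
  s <> s_run (accept N) -> s <> s_ask ->
  let ts := [tuple of t :: [tuple of u :: us]] in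
  sim_delta s (tapes_read ts) = [set ((s', act2 (tapes_read ts) a b, None) : sim_action)]%SET ->
  tape_eq (tape_act a t) t' -> tape_eq (tape_act b u) u' ->
  R n s' [tuple of t' :: [tuple of u' :: us]] o P -> R n.+1 s ts o P.
Proof.
move=> sa sq ts e h h' r; apply: reach_det e _ => //=; apply: reach_eq r.
apply: tapes_eq_trans (act2_eq _ _ _ _ _) _.
do 2!apply: tapes_eq_cons => //; exact: tapes_eq_refl.
Qed.

Lemma R_rewind_input n l r t (us : k.-tuple (tape g)) o P :
  R n (s_rewind None) [tuple of t :: [tuple of zipper g [::] (catrev l r) :: us]] o P ->
  R (size l + n.+1) s_rewind_input
    [tuple of t :: [tuple of zipper_left g l r :: us]] o P.
Proof.
elim: l r => [|b l IH] r h /=.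
  apply: R_act2 h => //; [exact: tape_eq_stay|exact: zipper_left_nil].
by apply: R_act2 (IH _ h) => //; exact: tape_eq_stay.
Qed.

(** The input arrives on the first tape. Each letter moves to the input tape of [N] and leaves a 0
    behind, which produces the part [0^n] of the padding. *)
Lemma R_copy n i l x (us : k.-tuple (tape g)) o P :
  R n s_rewind_input [tuple of zipper_left g (nseq (size x + i) false) [::] ::
    [tuple of zipper_left g (catrev x l) [::] :: us]] o P ->
  R (size x + n.+1) s_copy [tuple of zipper g (nseq i false) x ::
    [tuple of zipper g l [::] :: us]] o P.
Proof.
elim: x i l => [|b x IH] i l h /=.
  by apply: R_act2 h => //; exact: zipper_left_end.
by apply: R_act2 (IH i.+1 (b :: l) _) => //; rewrite addnS.
Qed.

Variables (n T : nat).
Hypothesis T_gt0 : 0 < T.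
Hypothesis X_grow : forall t : nat, t <= T ->
  X (c ++ nseq n false ++ nseq t true) <-> t < T.

Definition padding (t : nat) : word := nseq n false ++ nseq t true.

Lemma size_padding (t : nat) : size (padding t) = n + t.
Proof. by rewrite size_cat !size_nseq. Qed.

Lemma rev_paddingS (t : nat) : rev (padding t.+1) = true :: rev (padding t).
Proof. by rewrite /padding -addn1 nseqD catA /= -rev_rcons -cats1. Qed.

Definition load_time := size c + (n + T).*2 + 6.

Lemma R_grow m (t : nat) l r us P : t <= T -> catrev l r = padding t ->
  R m (s_rewind (Some (start N))) [tuple of zipper_left g (rev (padding T)) [::] :: us] [::] P ->
  R ((T - t).+1 * load_time + m) (s_rewind None) [tuple of zipper_left g l r :: us] [::] P.
Proof.
move: {2}(T - t) (erefl (T - t)) => j; elim: j t l r => [|j IH] t l r hj ht hw h.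
  have {}ht : t = T by lia.
  rewrite hj mul1n ht in hw *.
  apply: (@reach_leq _ _ _ _ _ _ _ _ _ _ (size c + (size (padding T)).*2 + m.+4)).
    by rewrite size_padding /load_time; lia.
  apply: R_load_ask hw _; case: asboolP => [/(X_grow (leqnn _))|_]; first by rewrite ltnn.
  by apply: R_act1 => //; apply: R_eq h; exact: zipper_left_end.
have ltT : t < T by lia.
apply: (@reach_leq _ _ _ _ _ _ _ _ _ _
  (size c + (size (padding t)).*2 + ((j.+1 * load_time + m).+4))).
  by rewrite size_padding hj mulSn /load_time; lia.
apply: R_load_ask hw _; rewrite asboolT; last by apply/X_grow => //; exact: ltnW.
apply: R_act1 => //.
have := IH t.+1 (rev (padding t.+1)) [::]; rewrite (_ : T - t.+1 = j); last by lia.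
rewrite catrevE revK cats0 => /(_ erefl ltT erefl h).
by rewrite rev_paddingS.
Qed.

Variables (B : language) (b : nat).
Hypothesis X_query : forall y, size y <= b ->
  X (c ++ padding T ++ false :: y) <-> B y.

Lemma query_step (d e : config N) : state d <> accept N -> state d = query N ->
  step B d e <-> e = Config (if `[< B (oracle_tape d) >] then answer_yes N else answer_no N)
    (tapes d) [::].
Proof.
move=> /eqP na q; split.
  case=> [a _ /eqP h _|_ _ h|_ _ h].
  - by case: (h q).
  - by rewrite asboolT.
  - by rewrite asboolF.
  by move=> ->; case: asboolP => h; [exact: step_yes|exact: step_no].
Qed.

Lemma run_action_inj h : injective (run_action h).
Proof.
move=> [[q acts] o] [[q' acts'] o'] [-> e ->].
by congr (_, _, _); apply: val_inj.
Qed.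

Lemma size_oracle_action a (d : config N) :
  size (oracle_tape (apply_action a d)) <= (size (oracle_tape d)).+1.
Proof. by case: a => [[q acts] [e|]] //=; rewrite size_rcons. Qed.

(** Strong induction on the remaining time [m]. An ordinary step costs one step and a query one
    reload, both within [load_time]. The bound on the oracle tape length plus [m] is preserved, so
    every query is short enough for [X_query]. *)
Lemma R_run m (d : config N) : bounded B m d -> size (oracle_tape d) + m <= b ->
  R (m.+1 * load_time) (s_run (state d))
    [tuple of zipper_left g (rev (padding T)) [::] :: tapes d]
    (c ++ padding T ++ false :: oracle_tape d) (accepting B d).
Proof.
(* Positivity of [T] puts the head on a 1; from this nonblank symbol [s_answer] knows that [N] is to
   be resumed. *)
have hT : head None (bits g (rev (padding T))) = Some (inl true).
  by case: (T) T_gt0 => // T' _; rewrite rev_paddingS.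
pose z := zipper_left g (rev (padding T)) [::].
have hz us : thead (tapes_read [tuple of z :: us]) = Some (inl true) by [].
elim/ltn_ind: m d => m IH d bd hb.
have [ha|/eqP ha] := eqVneq (state d) (accept N).
  rewrite ha; apply: (reach_iff (P := True)); last exact: reach_accept.
  by split=> // _; apply/accepting_step; left.
have na : s_run (state d) <> s_run (accept N) by case.
have [hq|/eqP hq] := eqVneq (state d) (query N).
  pose e := Config (if `[< B (oracle_tape d) >] then answer_yes N else answer_no N)
    (tapes d) [::].
  have st f : step B d f <-> f = e := query_step f ha hq.
  have [m0 be] := bounded_step bd (proj2 (st e) erefl).
  have acc : accepting B e <-> accepting B d.
    rewrite (accepting_step B d); split=> [h|[//|[f /st-> //]]].
    by right; exists e => //; apply/st.
  apply: (reach_iff acc).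
  apply: (@reach_leq _ _ _ _ _ _ _ _ _ _
    (size c + (size (padding T)).*2 + (m * load_time).+2).+3).
    by rewrite size_padding mulSn /load_time; lia.
  apply: (@R_stays _ _ s_ask _ _ None) => //=; first by rewrite hq eqxx.
  apply: reach_query => //.
  have -> : `[< X (c ++ padding T ++ false :: oracle_tape d) >] = `[< B (oracle_tape d) >].
    by apply: asbool_equiv_eq; apply: X_query; lia.
  apply: (@R_stays _ _ (s_rewind (Some (state e))) _ _ None) => //.
  - by case: asbool.
  - by case: asbool.
  - by rewrite /e; case: asbool; rewrite /sim_delta [thead _]hz.
  apply: R_load_run; first by rewrite catrevE revK cats0.
  by have := IH m.-1 _ e be; rewrite (ltn_predK m0) => /(_ (leqnn m)); apply=> /=; lia.
apply: (@reach_leq _ _ _ _ _ _ _ _ _ _ (m * load_time).+1).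
  by rewrite mulSn /load_time; lia.
have D : sim_delta (s_run (state d)) (tapes_read [tuple of z :: tapes d]) =
    (run_action (tape_read z) @: delta N (state d, tapes_read (tapes d)))%SET.
  by rewrite /= tapes_read_cons tuple_rest_cons; case: eqP.
have st a : a \in delta N (state d, tapes_read (tapes d)) -> step B d (apply_action a d).
  by move=> h; apply: step_delta => //; apply/eqP.
(* As [run_action] is injective, this predicate on simulator actions says that the corresponding
   successor of [d] accepts. *)
pose P a' := exists2 a, a' = run_action (tape_read z) a & accepting B (apply_action a d).
apply: reach_iff; last first.
  apply: (reach_step (P := P)) => // a'; rewrite D => /imsetP[a da ->].
  have [m0 be] := bounded_step bd (st a da).
  apply: (reach_iff (P := accepting B (apply_action a d))).
    by split=> [h|[a1 /run_action_inj -> //]]; exists a.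
  have ob : size (oracle_tape (apply_action a d)) + m.-1 <= b.
    by have := size_oracle_action a d; lia.
  have := IH m.-1; rewrite (ltn_predK m0) => /(_ (leqnn m) _ be ob).
  move: (accepting B _) => Q; case: a {da be ob} => [[q acts] e] /= r.
  rewrite tapes_act_cons (_ : emit _ e = c ++ padding T ++ false ::
    (if e is Some b then rcons (oracle_tape d) b else oracle_tape d)).
    by apply: R_eq r; exact: tape_eq_stay.
  by case: e {r} => [e|] //=; rewrite !rcons_cat.
rewrite D accepting_step; split.
  case=> a' /imsetP[a da ->] [a1 /run_action_inj <- h]; right.
  by exists (apply_action a d) => //; exact: st.
case=> [//|[e []]].
- move=> a _ _ da h; exists (run_action (tape_read z) a); last by exists a.
  exact: imset_f.
- by [].
- by [].
Qed.

Lemma sim_runs x : size x = n -> bounded B b (initial N x) ->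
  bounded X (n.*2 + T.+1 * load_time + b.+2 * load_time + 2) (initial sim x) /\
  (accepts sim X x <-> accepting B (initial N x)).
Proof.
move=> xn bx; apply: reach_initial.
pose us : k.-tuple (tape g) := [tuple blank_tape g | i < k].
have ts0 : tapes (initial N x) = [tuple of input_tape g x :: us].
  apply: eq_from_tnth => i; rewrite tnth_mktuple.
  by case: (unliftP ord0 i) => [j|] ->; rewrite ?tnthS ?tnth0 ?tnth_mktuple.
apply: (@reach_leq _ _ _ _ _ _ _ _ _ _
  (size x + (size (rev x) + (T.+1 * load_time + (b.+2 * load_time)).+1).+1)).
  by rewrite size_rev xn; lia.
have e0 : tapes_eq [tuple if i == ord0 then input_tape g x else blank_tape g | i < k.+2]
    [tuple of zipper g (nseq 0 false) x :: [tuple of zipper g [::] [::] :: us]].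
  move=> i; rewrite tnth_mktuple.
  case: (unliftP ord0 i) => [j|] ->; rewrite ?tnthS ?tnth0 //.
  by case: (unliftP ord0 j) => [j'|] ->; rewrite ?tnthS ?tnth0 ?tnth_mktuple.
apply: reach_eq e0 _; apply: R_copy; rewrite addn0 catrevE cats0.
apply: R_rewind_input; rewrite catrevE revK cats0.
(* Growth starts at [t = 0], with only [0^n] on the first tape. *)
rewrite -[X in X.+1 * _ + _](subn0 T); apply: R_grow => //.
  by rewrite catrevE rev_nseq xn.
apply: (@reach_leq _ _ _ _ _ _ _ _ _ _
  (size c + (size (padding T)).*2 + (b.+1 * load_time).+2)).
  by rewrite size_padding mulSn /load_time; lia.
apply: R_load_run; first by rewrite catrevE revK cats0.
by have := R_run bx (leqnn _); rewrite ts0.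
Qed.

End Simulation.

(** The padding has polynomial length, and [X] has to reproduce [B] only on words that [N] has time
    to write. *)
Lemma NP_sim (N : machine) (B X L : language) (p : {poly nat}) (c : word) (k : nat) :
  (forall x n d, steps B n (initial N x) d -> n <= p.[size x]%R) ->
  (forall x, L x <-> accepts N B x) ->
  (forall n t, t <= (n + 2) ^ k ->
     X (c ++ nseq n false ++ nseq t true) <-> t < (n + 2) ^ k) ->
  (forall n y, size y <= p.[n]%R ->
     X (c ++ padding n ((n + 2) ^ k) ++ false :: y) <-> B y) ->
  NP_oracle X L.
Proof.
move=> hp hL hg hq; exists (sim N c).
have T0 n : 0 < (n + 2) ^ k by rewrite expn_gt0 addn2.
have R x := sim_runs (T0 (size x)) (hg (size x)) (hq (size x)) erefl (fun m d => hp x m d).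
split; last by move=> x; case: (R x) => _ ->; exact: hL.
pose q : {poly nat} := (('X + 2%:P) ^+ k)%R.
(* This polynomial evaluates to [load_time]. *)
pose w : {poly nat} := ((size c + 6)%:P + 'X + 'X + q + q)%R.
exists ('X + 'X + (q + 1%:P) * w + (p + 2%:P) * w + 2%:P)%R => x n d.
case: (R x) => h _ /h.
rewrite !(hornerD, hornerM, hornerX, hornerC) horner_nat_pow /load_time.
move: (size x) ((size x + 2) ^ k) (p.[size x])%R (size c) => s t u v.
have -> : ((s + s + (t + 1) * (v + 6 + s + s + t + t)
  + (u + 2) * (v + 6 + s + s + t + t) + 2)%R : nat) =
  (s + s + (t + 1) * (v + 6 + s + s + t + t) + (u + 2) * (v + 6 + s + s + t + t) + 2)%N by [].
by move/leq_trans; apply; rewrite -!addnn; nia.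
Qed.

(** * Coding machines by numbers *)

Definition machine_data : countType :=
  {q : nat & {g : nat & {k : nat & ('I_q * 'I_q * 'I_q * 'I_q * 'I_q *
    {ffun 'I_q * k.+1.-tuple (symbol g) -> {set action q g k.+1}})%type}}}.

Definition machine_code (M : machine) : machine_data :=
  Tagged _ (Tagged _ (Tagged _
    (start M, accept M, query M, answer_yes M, answer_no M, delta M))).

Definition machine_decode (x : machine_data) : machine :=
  let: existT q (existT g (existT k (a, b, c, d, e, f))) := x in
  Machine a b c d e f.

Lemma machine_codeK : cancel machine_code machine_decode.
Proof. by case. Qed.

HB.instance Definition _ := Countable.copy machine (can_type machine_codeK).

Lemma joinE A B x : join A B x <->
  match x with [::] => False | false :: y => A y | true :: y => B y end.
Proof.
split; first by case=> -[y h <-].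
by case: x => [//|[] y h]; [right|left]; exists y.
Qed.

(** * Self-referential languages *)

(** Since [F] looks only at shorter words, its iterates from the empty set are stable at [z] after
    [size z + 1] rounds. *)
Lemma local_fixpoint (F : language -> language) :
  (forall (A B : language) z, (forall w, size w < size z -> A w <-> B w) ->
     F A z <-> F B z) ->
  exists K : language, forall z, K z <-> F K z.
Proof.
move=> loc; pose K := [set z | iter (size z).+1 F set0 z].
have KE n z : size z < n -> iter n F set0 z <-> K z.
  move: {2}(size z) (leqnn (size z)) => m.
  elim: m n z => [|m IH] [//|n] z zm zn; apply: loc => w wz; first by lia.
  by apply: (iff_trans (IH n w _ _) (iff_sym (IH (size z) w _ _))); lia.
exists K => z; apply: loc => w; exact: KE.
Qed.

(** Sending the bit [s j] along with a question to [K] thereby undoes a complementation of [K]. *)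
Lemma iff_boolK (P : Prop) (b : bool) : ((P <-> b) <-> b) <-> P.
Proof.
case: b; first by split=> [[_ h]|h]; [apply/h|split].
split=> [[h _]|h]; last by split=> // -[/(_ h)].
by apply: contrapT => np; have : is_true false by apply: h.
Qed.

Section Universal.
Variables (a : bool -> language) (s : bool -> bool).

Definition coded (K : language) (j : bool) : language :=
  [set x | match x with
           | [::] => False
           | false :: y => a j y
           | true :: y => K y <-> s j
           end].

(** The word [x = 1^m 0 0^n 1^t 0 y], where [m] is the number of [(M, k)], says that
    [M] with oracle [coded K j] accepts [y] in at most [t] steps; without [0 y] it
    says that [t < (n + 2) ^ k]. *)
Definition coded_query (K : language) (j : bool) (x : word) : Prop :=
  let m := find negb x in
  if unpickle m is Some (M, k) then
    let x1 := drop m.+1 x in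
    let n := find id x1 in
    let x2 := drop n x1 in
    let t := find negb x2 in
    if drop t x2 is _ :: y then
      exists2 i, i <= t & exists2 d : config M,
        steps (coded K j) i (initial M y) d & state d = accept M
    else t < (n + 2) ^ k
  else False.

(** The first bit sets the polarity, the second the kind of question, the third the oracle. The
    branch with [SAT] reduces [join (coded K j) SAT] to [coded K j], which gives the easy inclusion
    without a machine for satisfiability. *)
Definition code_step (K : language) : language :=
  [set z | match z with
           | b :: true :: j :: x => coded_query K j x <-> b
           | b :: false :: j :: x => join (coded K j) SAT x <-> b
           | _ => False
           end].

Lemma coded_local (A B : language) j x :
  (forall w, size w < size x -> A w <-> B w) -> coded A j x <-> coded B j x.
Proof. by case: x => [|[] x] //= h; rewrite h. Qed.

Lemma code_step_local (A B : language) z :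
  (forall w, size w < size z -> A w <-> B w) -> code_step A z <-> code_step B z.
Proof.
case: z => [|b [|[] [|j x]]] //= h.
  suff -> : coded_query A j x <-> coded_query B j x by [].
  rewrite /coded_query; case: unpickle => // -[M k].
  set x2 := drop _ (drop _ x); case: (drop _ x2) => // _ y.
  (* The simulated time is written in unary inside [x], so the simulated queries are shorter than
     [x]. *)
  have lx : find negb x2 <= size x.
    by rewrite (leq_trans (find_size _ _)) // !size_drop; lia.
  have tr (A' B' : language) : (forall w, size w < (size x).+3 -> A' w <-> B' w) ->
      (exists2 i, i <= find negb x2 & exists2 d : config M,
        steps (coded A' j) i (initial M y) d & state d = accept M) ->
      (exists2 i, i <= find negb x2 & exists2 d : config M,
        steps (coded B' j) i (initial M y) d & state d = accept M).
    move=> h' [i it [d sd ad]]; exists i => //; exists d => //.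
    have [qs [_ lq]] := steps_queries sd; apply=> q /lq /= qi.
    by apply: coded_local => w wq; apply: h'; lia.
  by split; apply: tr => w wx; rewrite h.
suff -> : join (coded A j) SAT x <-> join (coded B j) SAT x by [].
rewrite !joinE; case: x h => [|[] x] //= h.
by apply: coded_local => w wx; apply: h; lia.
Qed.

Lemma coded_query_word K j (M : machine) k z :
  coded_query K j (nseq (pickle (M, k)) true ++ false :: z) <->
  let n := find id z in
  let t := find negb (drop n z) in
  if drop t (drop n z) is _ :: y then
    exists2 i, i <= t & exists2 d : config M,
      steps (coded K j) i (initial M y) d & state d = accept M
  else t < (n + 2) ^ k.
Proof.
have fE : find negb (nseq (pickle (M, k)) true ++ false :: z) = pickle (M, k).
  by rewrite find_cat has_nseq /= andbF size_nseq addn0.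
rewrite /coded_query fE pickleK.
by rewrite drop_cat size_nseq ltnNge leqnSn /= subSnn /= drop0.
Qed.

Lemma find_nseq_cat (p : pred bool) c n z : ~~ p c -> find p (nseq n c ++ z) = n + find p z.
Proof. by move=> pc; rewrite find_cat has_nseq (negbTE pc) andbF size_nseq. Qed.

Theorem universal_code : exists K, forall j, EL2 (coded K j).
Proof.
have [K KE] := local_fixpoint code_step_local.
exists K => j; apply/seteqP; split=> L.
  move=> [B [M [[pM hM] BM]] [N [[p hp] LN]]].
  (* [N] asks words of length at most [p.[n]], on which [M] runs for at most [pM.[p.[n]]] steps; the
     padding exceeds this composition. *)
  have [k hk] := horner_nat_bound (pM \Po p)%R.
  (* The five bits select the left half of the join, the half of [coded] holding [K], the polarity,
     a simulation question, and the oracle. *)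
  have XE z : join (coded K j) SAT
      ([:: false; true; s j; true; j] ++ nseq (pickle (M, k)) true ++ false :: z) <->
      coded_query K j (nseq (pickle (M, k)) true ++ false :: z).
    by rewrite joinE /= KE; exact: iff_boolK.
  have T0 n : 0 < (n + 2) ^ k by rewrite expn_gt0 addn2.
  apply: (NP_sim (k := k) (c := [:: false; true; s j; true; j] ++
    rcons (nseq (pickle (M, k)) true) false) hp LN).
    move=> n t _; rewrite -catA cat_rcons XE coded_query_word /=.
    have -> : find id (nseq n false ++ nseq t true) = n.
      by rewrite find_nseq_cat //; case: t => [|t]; rewrite addn0.
    rewrite drop_size_cat ?size_nseq // -[nseq t true]cats0 find_nseq_cat // addn0.
    by rewrite drop_size_cat ?size_nseq.
  move=> n y ny; rewrite -catA cat_rcons XE coded_query_word /=.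
  rewrite /padding -catA.
  (* With [T] positive, the count of zeros stops at a 1 and does not run into the separator. *)
  have -> : find id (nseq n false ++ nseq ((n + 2) ^ k) true ++ false :: y) = n.
    by rewrite find_nseq_cat //; case: expn (T0 n) => // t _; rewrite addn0.
  rewrite drop_size_cat ?size_nseq // find_nseq_cat // addn0.
  rewrite drop_size_cat ?size_nseq // BM; apply: iff_sym; apply: accepts_bounded.
  move=> i d /hM /leq_trans; apply; apply: leq_trans (hk n).
  by rewrite horner_comp; exact: horner_nat_leq.
(* The converse inclusion: the joined oracle is itself in NP relative to [coded K j], by one
   question to [K]. *)
move=> hL; exists (join (coded K j) SAT) => //.
have -> : join (coded K j) SAT = [set x | exists2 y, scanned false x y &
    coded K j ([:: true; s j; false; j] ++ y) <-> true].
  have E x : (coded K j ([:: true; s j; false; j] ++ x) <-> true) <-> join (coded K j) SAT x.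
    have -> : coded K j ([:: true; s j; false; j] ++ x) <-> join (coded K j) SAT x.
      by rewrite /= KE; exact: iff_boolK.
    by split=> [->|].
  apply/seteqP; split=> x; first by move=> /E h; exists x.
  by case=> y -> /E.
exact: NP_scan.
Qed.

End Universal.

(** * A language outside the second level *)

Section Diagonal.
Variables (c e : Prop).

(** This is what remains once [K] cancels: [c] and [e] are the constants that the operation leaves
    on the half of [K] and on the empty word. *)
Definition padded (D : language) : language :=
  [set x | match x with [::] => e | false :: y => D y | true :: _ => c end].

Let X (D : language) : language := join (padded D) SAT.

Definition no_length (D : language) : language :=
  [set x | ~ exists2 y, size y = size x & D y].

Definition defeats (D : language) (M : machine) (k : nat) : Prop :=
  ~ ((forall x n d, steps (X D) n (initial M x) d -> n <= (size x + 2) ^ k) /\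
     (forall x, no_length D x <-> accepts M (X D) x)).

Definition supported (b : nat) (D : language) : Prop := forall y, D y -> size y < b.

Definition agree (b : nat) (D E : language) : Prop :=
  forall y, size y < b -> D y <-> E y.

Lemma pow_lt_exp k b : exists2 n, b <= n & (n + 2) ^ k < 2 ^ n.
Proof.
pose i := b + k.*2 + 2; have h : i.*2 * k + 2 < 2 ^ i.*2.
  have : i.+1 * i.+1 <= 2 ^ i.*2.
    by rewrite -addnn expnD; apply: leq_mul; exact: ltn_expl.
  by rewrite /i; nia.
have hi : i.*2 < 2 ^ i.*2 by exact: ltn_expl.
(* Then [n + 2] is a power of 2, and it remains to compare exponents. *)
exists (2 ^ i.*2 - 2); first by rewrite /i in hi *; lia.
rewrite subnK; last by lia.
by rewrite -expnM ltn_exp2l //; move: (2 ^ _) h => q; lia.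
Qed.

Lemma fresh_word n (qs : seq word) (f : word -> word) : injective f ->
  size qs < 2 ^ n -> exists2 y, size y = n & f y \notin qs.
Proof.
move=> fi sq; apply: contrapT => h.
have : size [seq f (val y) | y : n.-tuple bool] <= size qs.
  apply: uniq_leq_size.
    by rewrite map_inj_uniq ?enum_uniq // => y z /fi /val_inj.
  move=> q /mapP[y _ ->]; apply/negPn/negP => hy; apply: h.
  by exists (val y) => //; exact: size_tuple.
by rewrite size_map -cardE card_tuple card_bool leqNgt sq.
Qed.

Lemma agree_X b D E : agree b D E -> forall q, size q < b -> X D q <-> X E q.
Proof.
move=> h q; rewrite /X !joinE; case: q => [|[] [|[] q]] //= hq.
by apply: h; lia.
Qed.

(** Run [M] on [0^n], with [n] so large that length [n] is untouched and has more words than there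
    are steps. If [M] accepts, a word of length [n] off an accepting path is added; otherwise length
    [n] stays empty. The new bound [b'] freezes all words that matter. *)
Lemma diagonal_step M k b D : supported b D ->
  exists D' b', [/\ b <= b', agree b D' D, supported b' D' &
    forall E, agree b' E D' -> defeats E M k].
Proof.
move=> bD; have [n bn nk] := pow_lt_exp k b.
pose x := nseq n false; pose t := (n + 2) ^ k.
have sx : size x = n by rewrite size_nseq.
have [[i it [d sd ad]]|rej] := pselect (exists2 i, i <= t &
    exists2 d : config M, steps (X D) i (initial M x) d & state d = accept M).
  have [qs [sq lq tr]] := steps_queries sd.
  (* The two tags lead through the join and through [padded] to [D]. *)
  have [y yn yq] : exists2 y, size y = n & [:: false, false & y] \notin qs.
    by apply: (@fresh_word _ _ (fun y => [:: false, false & y])) => [? ? []|] //;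
      exact: leq_ltn_trans (leq_trans sq it) nk.
  exists (D `|` [set y]), (n.+1 + t); split; first by lia.
  - move=> z zb; split=> [[//|/= zy]|]; last by left.
    by move: zb; rewrite zy yn; lia.
  - by move=> z [/bD|->]; lia.
  move=> E hE [_ /(_ x)[_ acc]]; apply: acc; last first.
    by exists y; rewrite ?sx //; apply/hE; [lia|right].
  exists i, d; split=> //; apply: tr => q qq.
  rewrite (agree_X hE); last by have := lq q qq; rewrite /=; lia.
  rewrite /X !joinE; case: q qq => [|[] [|[] q]] //= qq.
  split; [by left|case=> // qy].
  by rewrite -qy qq in yq.
exists D, (n.+1 + t); split=> //; first by lia.
  by move=> z /bD; lia.
move=> E hE [bE /(_ x)[acc _]].
have [[y yx Ey]|/acc[i [d [sd ad]]]] := pselect (exists2 y, size y = size x & E y).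
  have /bD : D y by apply/hE => //; rewrite yx sx; lia.
  by rewrite yx sx; lia.
(* The clock makes this accepting path short, so it survives the change from [E] to [D] and
   contradicts [rej]. *)
have it := bE _ _ _ sd; rewrite sx in it.
have [qs [_ lq tr]] := steps_queries sd.
apply: rej; exists i => //; exists d => //; apply: tr => q qq.
by apply: agree_X hE _ _; have := lq q qq; rewrite /= /t; lia.
Qed.

Lemma diagonal : exists D, forall M k, defeats D M k.
Proof.
(* One stage, as an implication so that choice gives a total function; stage [i] treats the pair
   with code [i], if any. *)
pose P (x : nat * (language * nat)) (y : language * nat) := supported x.2.2 x.2.1 ->
  [/\ x.2.2 <= y.2, agree x.2.2 y.1 x.2.1, supported y.2 y.1 &
    forall M k, unpickle x.1 = Some (M, k) -> forall E, agree y.2 E y.1 -> defeats E M k].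
have /choice[f fP] : forall x, exists y, P x y.
  move=> [i [D b]]; rewrite /P /=.
  have [bD|nD] := pselect (supported b D); last by exists (D, b).
  case: (unpickle i) => [[M k]|]; last by exists (D, b).
  have [D' [b' [h1 h2 h3 h4]]] := diagonal_step M k bD.
  by exists (D', b') => _; split=> // M' k' [<- <-].
pose st := fix st i := if i is i'.+1 then f (i', st i') else (set0, 0).
have sup i : supported (st i).2 (st i).1.
  by elim: i => [|i IH] //=; case: (fP (i, st i) IH).
have stS i := fP (i, st i) (sup i).
have mono i j : i <= j -> (st i).2 <= (st j).2 /\ agree (st i).2 (st j).1 (st i).1.
  move=> /subnKC <-; elim: (j - i) => [|m [IH1 IH2]]; first by rewrite addn0.
  rewrite addnS /=; case: (stS (i + m)) => /= h1 h2 _ _; split; first exact: leq_trans h1.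
  by move=> y hy; rewrite h2 ?IH2 //; exact: leq_trans IH1.
pose D := [set y | exists2 i, size y < (st i).2 & (st i).1 y].
have DE i : agree (st i).2 D (st i).1.
  move=> y hy; split=> [[j hj sj]|]; last by exists i.
  have /orP[/mono[_ h]|/mono[_ h]] := leq_total i j; first by apply/h.
  by apply/h.
exists D => M k; have [_ _ _ h] := stS (pickle (M, k)).
by apply: (h M k (pickleK _)); exact: (DE (pickle (M, k)).+1).
Qed.

Lemma padded_not_EL2 : exists D, ~ EL2 (padded D).
Proof.
have [D hD] := diagonal; exists D => E.
have : NP_class (NP_oracle (padded D)) (no_length D).
  (* The inner NP oracle guesses a word of [D] of the input length; the outer machine accepts on the
     answer no. *)
  exists [set x | exists2 y, scanned true x y & padded D ([:: false] ++ y) <-> true].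
    exact: NP_scan.
  rewrite (_ : no_length D = [set x | exists2 y, scanned false x y &
    [set x | exists2 y, scanned true x y & padded D ([:: false] ++ y) <-> true]
      ([::] ++ y) <-> false]); first exact: NP_scan.
  apply/seteqP; split=> x /=.
    move=> h; exists x => //; split=> // -[y yx hy]; case: h; exists y => //.
    exact/hy.
  case=> y -> [h _] [z zx Dz]; suff : is_true false by [].
  by apply: h; exists z.
rewrite E => -[M [[p hp] hM]]; have [k hk] := horner_nat_bound p.
apply: (hD M k); split=> // x n d /hp /leq_trans; exact.
Qed.

End Diagonal.

(** * The four operations *)

Theorem theorem3p7 :
  [/\ exists A1 A2 : language, [/\ EL2 A1, EL2 A2 & ~ EL2 (A1 `&` A2)],
      exists A1 A2 : language, [/\ EL2 A1, EL2 A2 & ~ EL2 (A1 `|` A2)],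
      exists A1 A2 : language, [/\ EL2 A1, EL2 A2 & ~ EL2 (A1 `+` A2)]
    & exists A1 A2 : language,
        [/\ EL2 A1, EL2 A2 & ~ EL2 (equivalence A1 A2)]].
Proof.
have combine (op : language -> language -> language) c e (a : language -> bool -> language) s :
    (forall D K, op (coded (a D) s K true) (coded (a D) s K false) = padded c e D) ->
    exists A1 A2 : language, [/\ EL2 A1, EL2 A2 & ~ EL2 (op A1 A2)].
  move=> h; have [D hD] := padded_not_EL2 c e; have [K hK] := universal_code (a D) s.
  by exists (coded (a D) s K true), (coded (a D) s K false); rewrite h.
have [tt nf] : true /\ ~ false by [].
have xorE (A B : language) x : (A `+` B) x <-> (A x <-> ~ B x).
  split=> [[[]|[]]|h]; [by split|by split|].
  by have [b|b] := pselect (B x); [right|left]; split=> //; rewrite ?h.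
split.
(* For intersection and union, one language carries [K] and the other its complement, next to the
   same [D]. *)
- apply: (combine _ False False (fun D _ => D) id) => D K.
  by apply/seteqP; split=> -[|[] y] //=; rewrite /coded /setI /=; tauto.
- apply: (combine _ True False (fun D _ => D) id) => D K.
  by apply/seteqP; split=> -[|[] y] //=; rewrite /coded /setU /=; try have := EM (K y); tauto.
(* For exclusive-or and equivalence both carry [K] itself, and [D] is paired with the neutral set of
   the operation. *)
- apply: (combine _ False False (fun D j => if j then D else set0) (fun=> true)) => D K.
  by apply/seteqP; split=> -[|[] y]; rewrite xorE /=; tauto.
- apply: (combine _ True True (fun D j => if j then D else setT) (fun=> true)) => D K.
  by apply/seteqP; split=> -[|[] y] //=; rewrite /equivalence /=; tauto.
Qed.
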